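(* Let $m \geq 2$ be an integer. Then $g(m,2) = 5m-4$.
   Context: For positive integers $m$ and $r$, $g(m,r)$ denotes the least positive integer $N$ such that for every map $\Delta:\{1,2,\ldots,N\}\to\{1,2,\ldots,r\}$ there exist $2m$ integers $x_1<\cdots<x_m<y_1<\cdots<y_m$ in $\{1,\ldots,N\}$ with $\Delta(x_1)=\cdots=\Delta(x_m)$, $\Delta(y_1)=\cdots=\Delta(y_m)$, and $2(x_m-x_1)\leq y_m-x_1$. *)

(* Defs.v *)
From mathcomp Require Import all_boot.

Set Implicit Arguments.
Unset Strict Implicit.
Unset Printing Implicit Defensive.

(* [1, N] and the index range [1, m] are represented by guarded naturals, so
   the values of D, x and y outside these ranges are irrelevant. *)
Definition coloring (N r : nat) (D : nat -> nat) : Prop :=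
  forall i, 1 <= i <= N -> 1 <= D i <= r.

Definition mono_mset (N m : nat) (D x : nat -> nat) : Prop :=
  [/\ forall i, 1 <= i <= m -> 1 <= x i <= N,
      forall i j, 1 <= i -> i < j -> j <= m -> x i < x j
    & forall i j, 1 <= i <= m -> 1 <= j <= m -> D (x i) = D (x j)].

(* The truncated subtractions are exact: x 1 <= x m < y 1 <= y m. *)
Definition good_pair (N m : nat) (D x y : nat -> nat) : Prop :=
  [/\ mono_mset N m D x,
      mono_mset N m D y,
      x m < y 1
    & 2 * (x m - x 1) <= y m - x 1].

Definition forcing (m r N : nat) : Prop :=
  forall D : nat -> nat, coloring N r D -> exists x y, good_pair N m D x y.

(* g is given by its graph: g(m, r) = N. *)
Definition is_g (m r N : nat) : Prop :=
  [/\ 0 < N, forcing m r N & forall N', 0 < N' -> forcing m r N' -> N <= N'].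

Lemma is_g_uniq m r N1 N2 : is_g m r N1 -> is_g m r N2 -> N1 = N2.
Proof.
move=> [p1 f1 l1] [p2 f2 l2].
by apply/eqP; rewrite eqn_leq l1 // l2.
Qed.

(* Main.v *)
Require Import Defs.
From mathcomp Require Import all_boot.
From mathcomp Require Import zify.

(** Upper bound: by pigeonhole, [1, 2m-1] contains a monochromatic m-set x and
    [2m, 4m-2] a monochromatic m-set y.  As 2 x_m - x_1 <= 4m-3, it suffices to
    have y_m >= 4m-3.  If this fails, either the colour of y reappears in
    [4m-3, 5m-4], and y_m can be moved there, or this block of m integers is
    monochromatic and can replace y.

    Lower bound: [1, 5m-5] is coloured 1 2^(m-1) 1^(m-1) 2^(2m-3) 1^(m-1).  A
    monochromatic m-set x followed by another one either forces y_m >= 4m-3,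
    where only the last block remains for y, or leaves too few integers of each
    colour to its right. *)

Lemma mono_mset_gap {N m : nat} {D x : nat -> nat} :
  mono_mset N m D x ->
  forall i j, 1 <= i -> i <= j -> j <= m -> x i + (j - i) <= x j.
Proof.
move=> [_ xlt _] i j i1; elim: j => [|j IH] ij jm; first by lia.
case: (eqVneq i j.+1) => [->|ne]; first by lia.
by have := IH ltac:(lia) ltac:(lia); have := xlt j j.+1 ltac:(lia) ltac:(lia) jm; lia.
Qed.

(** The first [m] integers of colour [c], in increasing order, serve as [z]. *)
Lemma mono_mset_of_count {N m a n c : nat} {D : nat -> nat} :
  a + n <= N -> m <= count (fun i => D i == c) (iota a.+1 n) ->
  exists2 z, mono_mset N m D z & forall i, 1 <= i <= m -> a < z i <= a + n.
Proof.
move=> anN; rewrite -size_filter; set s := filter _ _ => ms.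
have s_lt : sorted ltn s := sorted_filter ltn_trans _ (iota_ltn_sorted _ _).
have s_in i : 1 <= i <= m -> (D (nth 0 s i.-1) == c) && (a < nth 0 s i.-1 <= a + n).
  move=> im; have : nth 0 s i.-1 \in s by apply: mem_nth; apply: leq_trans ms; lia.
  by rewrite mem_filter mem_iota addSn ltnS => /andP[-> ->].
exists (fun i => nth 0 s i.-1) => [|i /s_in/andP[_ ]//]; split=> [i /s_in|i j i1 ij jm|i j].
- by lia.
- by apply: (sorted_ltn_nth ltn_trans) => //; rewrite ?inE; lia.
- by move=> /s_in/andP[/eqP-> _] /s_in/andP[/eqP-> _].
Qed.

Lemma mono_mset_pigeonhole {N m a : nat} {D : nat -> nat} :
  coloring N 2 D -> 0 < m -> a + (2 * m - 1) <= N ->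
  exists2 z, mono_mset N m D z &
    forall i, 1 <= i <= m -> a < z i <= a + (2 * m - 1).
Proof.
move=> DC m0 aN; set s := iota a.+1 (2 * m - 1).
(* Only two colours occur, so one of the two counts is at least [m]. *)
have sum_count : count (fun i => D i == 1) s + count (fun i => D i == 2) s = 2 * m - 1.
  rewrite -[RHS](size_iota a.+1) -/s -(count_predC (fun i => D i == 1) s).
  congr (_ + _); apply: eq_in_count => i; rewrite mem_iota => si /=.
  by have := DC i ltac:(lia); lia.
case: (leqP m (count (fun i => D i == 1) s)) => cm.
  exact: (mono_mset_of_count aN cm).
have cm2 : m <= count (fun i => D i == 2) s by lia.
exact: (mono_mset_of_count aN cm2).
Qed.

Lemma forcing_upper (m : nat) : 2 <= m -> forcing m 2 (5 * m - 4).
Proof.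
move=> hm D DC.
have [x xM xr] := mono_mset_pigeonhole (m := m) (a := 0) DC ltac:(lia) ltac:(lia).
have [y yM yr] := mono_mset_pigeonhole (m := m) (a := 2 * m - 1) DC ltac:(lia) ltac:(lia).
have x1 := xr 1 ltac:(lia); have xm := xr m ltac:(lia).
have [y_large|y_small] := leqP (4 * m - 3) (y m).
  exists x, y; split=> //; last by lia.
  by have := yr 1 ltac:(lia); lia.
have [yN ylt yD] := yM.
case: (boolP (has (fun i => D i == D (y m)) (iota (4 * m - 3) m))).
  case/hasP=> w; rewrite mem_iota => wr /eqP Dw.
  exists x, (fun i => if i == m then w else y i).
  split=> //; last by rewrite eqxx; lia.
    split=> [i im|i j i1 ij jm|i j im jm].
    - by case: eqP => _; [lia | exact: yN].
    - have -> : (i == m) = false by lia.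
      case: eqP => [jE|_]; last exact: ylt.
      by have := ylt i m i1 ltac:(lia) (leqnn m); lia.
    - by do 2![case: eqP => _]; rewrite ?Dw //; apply: yD; lia.
  have -> : (1 == m) = false by lia.
  by have := yr 1 ltac:(lia); lia.
(* The whole block avoids the colour of [y m], so it has the other colour throughout. *)
move=> /hasPn wD.
exists x, (fun i => 4 * m - 4 + i); split=> //; try lia.
split=> [i im|i j *|i j im jm]; try lia.
have wi := wD (4 * m - 4 + i); have wj := wD (4 * m - 4 + j).
rewrite !mem_iota in wi wj.
have := wi ltac:(lia); have := wj ltac:(lia).
have := DC (4 * m - 4 + i) ltac:(lia); have := DC (4 * m - 4 + j) ltac:(lia).
by have := DC _ (yN m ltac:(lia)); lia.
Qed.

(** The blocks are {1}, [2, m], [m+1, 2m-1], [2m, 4m-4] and [4m-3, 5m-5]. The last is left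
    unbounded, so one function serves all [N <= 5 * m - 5]. *)
Definition extremal_coloring (m i : nat) : nat :=
  if [|| i <= 1, m < i < 2 * m | 4 * m - 3 <= i] then 1 else 2.

Section ExtremalColoring.

Variables (m u v : nat).
Hypotheses (hm : 2 <= m) (Duv : extremal_coloring m u = extremal_coloring m v).

Lemma extremal_after_one : u = 1 -> 1 < v -> m < v.
Proof. by move: Duv; rewrite /extremal_coloring; do 2![case: ifP]; lia. Qed.

Lemma extremal_after_block2 : 1 < u <= m -> m < v -> 2 * m <= v.
Proof. by move: Duv; rewrite /extremal_coloring; do 2![case: ifP]; lia. Qed.

Lemma extremal_after_block3 : m < u < 2 * m -> 2 * m <= v -> 4 * m - 3 <= v.
Proof. by move: Duv; rewrite /extremal_coloring; do 2![case: ifP]; lia. Qed.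

Lemma extremal_before_block5 : 2 * m <= u -> 4 * m - 3 <= v -> 4 * m - 3 <= u.
Proof. by move: Duv; rewrite /extremal_coloring; do 2![case: ifP]; lia. Qed.

End ExtremalColoring.

Lemma extremal_coloring_avoids (m N : nat) (x y : nat -> nat) :
  2 <= m -> N <= 5 * m - 5 -> ~ good_pair N m (extremal_coloring m) x y.
Proof.
move=> hm hN [xM yM xy gap].
have xgap := mono_mset_gap xM; have [xN _ xD] := xM; have [yN _ yD] := yM.
have x1 := xN 1 ltac:(lia); have ym := yN m ltac:(lia).
have x1m := xgap 1 m ltac:(lia) ltac:(lia) ltac:(lia).
have y1m := mono_mset_gap yM 1 m ltac:(lia) ltac:(lia) ltac:(lia).
(* Otherwise [y 1] also lies in the last block, which has only m-1 integers. *)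
have y_early : 2 * m <= y 1 -> y m < 4 * m - 3.
  have Dy := yD 1 m ltac:(lia) ltac:(lia).
  by have := extremal_before_block5 _ _ _ hm Dy; lia.
have [x1_le1|x1_gt1] := leqP (x 1) 1.
  (* Here [x 2 >= m+1], so [x m >= 2m-1] and [gap] forces [y m >= 4m-3], against [y_early]. *)
  have x12 := xgap 1 2 ltac:(lia) ltac:(lia) ltac:(lia).
  have x2m := xgap 2 m ltac:(lia) ltac:(lia) ltac:(lia).
  have Dx := xD 1 2 ltac:(lia) ltac:(lia).
  by have := extremal_after_one _ _ _ hm Dx; lia.
have [x1_lem|x1_gtm] := leqP (x 1) m.
  (* The index from which on x has left the first block of colour 2. *)
  pose j := m - x 1 + 2.
  have x1j := xgap 1 j ltac:(lia) ltac:(lia) ltac:(lia).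
  have xjm := xgap j m ltac:(lia) ltac:(lia) ltac:(lia).
  have Dx := xD 1 j ltac:(lia) ltac:(lia).
  (* Since [x j >= 2m], [x m >= 2m + x 1 - 2], whence [y m >= 2 * x m - x 1 >= 4m-2]. *)
  by have := extremal_after_block2 _ _ _ hm Dx; lia.
(* If [x 1 >= 2m], then [y m >= x 1 + 2m-1 >= 4m-1]. *)
have [x1_ge2m|x1_lt2m] := leqP (2 * m) (x 1); first by lia.
(* The third block has only m-1 integers, so [x m] leaves it and is at least 4m-3. *)
have Dx := xD 1 m ltac:(lia) ltac:(lia).
by have := extremal_after_block3 _ _ _ hm Dx; lia.
Qed.

Theorem theorem3p1 (m : nat) (hm : 2 <= m) : is_g m 2 (5 * m - 4).
Proof.
split=> [||N _ NF]; [by lia | exact: forcing_upper |].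
rewrite leqNgt; apply/negP => ltN.
have colE : coloring N 2 (extremal_coloring m).
  by move=> i _; rewrite /extremal_coloring; case: ifP.
have [x [y]] := NF _ colE.
by apply: extremal_coloring_avoids => //; lia.
Qed.
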